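(* The map $f\mapsto \hat{\mathcal P} f$ is of weak type $(1,1)$. Specifically, there is a constant $K_1$, independent of $f$, such that for every $f\in L^1(\mathbb{R})$ and every $\lambda>0$, $$ \left|\{\rho\in\mathbb{R}_+ : \hat{\mathcal P} f(\rho)>\lambda\}\right|\;\le\; K_1\,\frac{\|f\|_1}{\lambda}. $$
   Context: Here $\mathbb{R}_+=(0,\infty)$, $|\cdot|$ denotes Lebesgue measure of a subset of $\mathbb{R}$, and functions are measurable and complex-valued. For $f$ on $\mathbb{R}$, the Poisson integral is the harmonic function in the upper half-plane ($y>0$) $$ \mathcal P f(x+iy)=\frac1\pi\int_{-\infty}^\infty \frac{y}{(t-x)^2+y^2}\,f(t)\,dt . $$ The angular maximal Poisson transform $\hat{\mathcal P}$ sends $f$ to the function of $\rho\in\mathbb{R}_+$ with values in $[0,\infty]$, $$ \hat{\mathcal P} f(\rho)=\sup_{0<\theta<\pi}\left|\mathcal P f(\rho e^{i\theta})\right|=\frac1\pi\sup_{0<\theta<\pi}\left|\int_{-\infty}^\infty\frac{\rho\sin\theta}{(t-\rho\cos\theta)^2+(\rho\sin\theta)^2}\,f(t)\,dt\right| . $$ *)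

(* Defs.v *)
From HB Require Import structures.
From mathcomp Require Import all_boot all_order all_algebra.
From mathcomp Require Import all_classical all_reals all_analysis.
From mathcomp.real_closed Require Import complex.

Set Implicit Arguments.
Unset Strict Implicit.
Unset Printing Implicit Defensive.
Import Order.TTheory GRing.Theory Num.Theory.
Import numFieldNormedType.Exports.
Local Open Scope classical_set_scope.
Local Open Scope ring_scope.
Local Open Scope complex_scope.

(* Complex modulus as an element of R; the norm `|z| of R[i] is R[i]-valued,
   with `|z| = (cabs z)%:C. *)
Notation cabs := Normc.normc.

Section ComplexIntegration.
Context {d : measure_display} {T : measurableType d} {R : realType}.
Variable mu : {measure set T -> \bar R}.
Implicit Types f g : T -> R[i].

Definition norm1 f : \bar R := ('N[mu]_1 [ (fun t => (cabs (f t))%:E) ])%E.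

Definition inL1 f : Prop :=
  [/\ measurable_fun [set: T] (fun t => complex.Re (f t)),
      measurable_fun [set: T] (fun t => complex.Im (f t)) &
      (norm1 f < +oo)%E].

(* Meaningful only for g in L^1, Rintegral being total. *)
Definition cintegral g : R[i] :=
  (\int[mu]_t complex.Re (g t)) +i* (\int[mu]_t complex.Im (g t)).

End ComplexIntegration.

(* completed_lebesgue_measure is Lebesgue measure on the sigma-algebra of all
   Lebesgue measurable sets, whereas lebesgue_measure is a measure on the
   Borel sigma-algebra only. *)
Section Poisson.
Context {R : realType}.
Implicit Types (f : R -> R[i]) (z : R[i]) (rho : R).

Definition poisson f z : R[i] :=
  let: x +i* y := z in
  (pi^-1)%:C * cintegral (@completed_lebesgue_measure R)
                 (fun t => (y / ((t - x) ^+ 2 + y ^+ 2))%:C * f t).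

Definition angular_maximal_poisson f rho : \bar R :=
  ereal_sup [set (cabs (poisson f (rho%:C * (cos theta +i* sin theta))))%:E
            | theta in [set theta : R | 0 < theta < pi]].

End Poisson.

(* Main.v *)
Require Import Defs.
From mathcomp Require Import all_boot all_order all_algebra.
From mathcomp Require Import all_classical all_reals all_analysis.
From mathcomp.real_closed Require Import complex.
From mathcomp Require Import finmap measurable_realfun ring lra.
Import Order.TTheory GRing.Theory Num.Theory.
Import numFieldNormedType.Exports.
Local Open Scope classical_set_scope.
Local Open Scope ring_scope.

Set Implicit Arguments.
Unset Strict Implicit.
Unset Printing Implicit Defensive.

(** The angular supremum is controlled by averages of |f| over balls centred at
    rho and at - rho.  On the unit half circle either 1 - cos theta or
    1 + cos theta is at most sin theta, so the point rho * e^(i theta), of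
    abscissa x and height y, satisfies |x - s| <= y with s = rho or s = - rho:
    it lies in the 45 degree cone above one of these two boundary points
    (angular_point_in_cone).

    Inside the cone above s, the Poisson kernel is dominated by a sum over k of
    (4 / 4^k) / y times the indicator of the ball of centre s and radius
    2^(k+1) y (poisson_kernel_dyadic_bound).  If the integral of |f| over the
    ball of centre s and radius r is at most A r for all r, then the k-th term
    contributes at most 8 A / 2^k, so the Poisson integral of |f| is at most
    16 A up to the factor 1 / pi (poisson_integral_le_ball_averages).  The real
    and imaginary parts of f are bounded separately, whence
    |P f (x + iy)| <= 32 A (cabs_poisson_le).

    Consequently, when the angular maximal function exceeds lambda at rho,
    there is a ball centred at rho or at - rho of radius r over which |f| has
    integral at least (lambda / 32) r.  The union of such heavy balls has
    measure at most 6 / (lambda / 32) times the norm of f: any compact part of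
    it is covered by finitely many heavy balls, and the Vitali lemma
    extracts disjoint ones whose threefold dilations still cover it
    (lebesgue_heavy_balls_le).  The balls centred at - rho are handled by the
    same lemma, applied to the image of |f| under t |-> - t; adding the two
    halves gives the constant 2 * 6 * 32 = 384. *)

(** * A dyadic bound for the Poisson kernel *)

(** The right k is the first one for which the ball of radius 2^(k+1) y around
    s contains t: for k > 0, minimality gives |t - s| >= 2^k y, and moving from
    s to x costs at most y <= 2^(k-1) y, so |t - x| >= 2^(k-1) y. *)
Lemma poisson_kernel_dyadic_bound (R : realType) (x y s t : R) :
  0 < y -> `|x - s| <= y ->
  exists k : nat, `|t - s| < 2 ^+ k.+1 * y /\
    y / ((t - x) ^+ 2 + y ^+ 2) <= 4 / 4 ^+ k / y.
Proof.
move=> y0 xs; have y_neq0 : y != 0 by rewrite gt_eqF.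
have exk : exists k : nat, `|t - s| < 2 ^+ k.+1 * y.
  exists (Num.bound (`|t - s| / y)); rewrite -ltr_pdivrMr//.
  apply: (lt_trans (archi_boundP _)); first by rewrite divr_ge0// ltW.
  by rewrite -natrX ltr_nat (ltn_trans (ltnSn _))// ltn_expl.
case: (ex_minnP exk) => k tk kmin; exists k; split=> //.
have den_gt0 : 0 < (t - x) ^+ 2 + y ^+ 2 by rewrite ltr_wpDl ?sqr_ge0 ?exprn_gt0.
(* For k = 0 the bound only has to beat the global maximum 1 / y. *)
case: k tk kmin => [|k] _ kmin.
  rewrite expr0 divr1 ler_pdivrMr// mulrAC ler_pdivlMr//.
  by have := sqr_ge0 (t - x); nra.
have far : 2 ^+ k * y <= `|t - x|.
  have : 2 ^+ k.+1 * y <= `|t - s|.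
    by rewrite leNgt; apply/negP => /kmin; rewrite ltnn.
  have : `|t - s| <= `|t - x| + `|x - s| by rewrite -[t - s](subrKA x) ler_normD.
  have : 1 <= 2 ^+ k :> R by rewrite exprn_ege1// ler1n.
  by rewrite [2 ^+ k.+1]exprS; nra.
rewrite [4 ^+ k.+1]exprS invfM mulrA divff// mul1r -invfM.
have -> : (4 ^+ k * y)^-1 = y / (4 ^+ k * y ^+ 2).
  by rewrite expr2 !invfM; field; rewrite y_neq0/= expf_neq0.
rewrite ler_pM2l// lef_pV2 ?posrE ?mulr_gt0 ?exprn_gt0//.
have -> : 4 ^+ k * y ^+ 2 = (2 ^+ k * y) ^+ 2.
  by rewrite exprMn [in RHS]exprAC (_ : 2 ^+ 2 = 4)//; ring.
rewrite (le_trans (lerXn2r 2 _ _ far)) ?nnegrE ?mulr_ge0 ?exprn_ge0 ?(ltW y0)//.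
by rewrite real_normK ?num_real// lerDl sqr_ge0.
Qed.

Lemma continuous_poisson_kernel (R : realType) (x y : R) :
  0 < y -> continuous (fun v : R => y / ((v - x) ^+ 2 + y ^+ 2)).
Proof.
move=> y0 v; apply: cvgM; first exact: cvg_cst.
apply: cvgV; first by rewrite gt_eqF// ltr_wpDl ?sqr_ge0 ?exprn_gt0.
apply: cvgD; last exact: cvg_cst.
by rewrite expr2; apply: cvgM; (apply: cvgB; [exact: cvg_id|exact: cvg_cst]).
Qed.

(** * Masses of balls *)

(** The map phi transports the density g to the line.  The source space is kept
    abstract so that the completed Lebesgue measure space can be used with both
    t |-> t and t |-> - t, without a change of variables. *)
Section BallMasses.
Context {d : measure_display} {T : measurableType d} {R : realType}.
Variables (mu : {measure set T -> \bar R}) (phi : T -> R) (g : T -> \bar R).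
Hypothesis mphi : measurable_fun [set: T] phi.
Hypothesis mg : measurable_fun [set: T] g.
Hypothesis g_ge0 : forall t, (0 <= g t)%E.

Let mass (c r : R) : \bar R := (\int[mu]_(t in phi @^-1` ball c r) g t)%E.

Lemma measurable_preimage_ball (c r : R) : measurable (phi @^-1` ball c r).
Proof.
by rewrite -[X in measurable X]setTI; apply: mphi => //; exact: measurable_ball.
Qed.

(** Inner regularity and compactness reduce the union to finitely many balls,
    and the Vitali lemma to the dilations by 3 of disjoint ones.  A ball of
    radius 3 r has measure 6 r, at most 6 / A times the mass of the ball of
    radius r; disjointness lets the masses be added up. *)
Lemma lebesgue_heavy_balls_le (A : R) (S : set (R * {posnum R})) :
  0 < A -> (forall p, S p -> ((A * p.2%:num)%:E <= mass p.1 p.2%:num)%E) ->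
  (lebesgue_measure (\bigcup_(p in S) ball p.1 p.2%:num)
     <= (6 / A)%:E * \int[mu]_t g t)%E.
Proof.
move=> A0 heavy; pose B (p : R * {posnum R}) : set R := ball p.1 p.2%:num.
have oB p : open (B p) by exact: ball_open.
rewrite lebesgue_regularity_inner_sup; last first.
  by apply: open_measurable; apply: bigcup_open => p _; exact: oB.
apply: ge_ereal_sup => _ /= [K [cK KS] <-].
have [D DS KD] : finite_subset_cover S B K.
  by move: (cK); rewrite compact_cover => /(_ _ S B (fun p _ => oB p)); apply.
have ballB p : is_ball (B p) by exact: is_ball_ball.
have B_neq0 p : B p !=set0 by exists p.1; exact: ballxx.
have [E [uE ED tEB DE]] := @vitali_lemma_finite_cover _ _ B ballB B_neq0 D.
have KE : K `<=` \big[setU/set0]_(p <- E) (3 *` B p).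
  by apply: (subset_trans KD); apply: (subset_trans DE); rewrite /cover bigcup_seq.
have leb3 p : lebesgue_measure (3 *` B p) = (6 * p.2%:num)%:E.
  by rewrite scale_ballE// lebesgue_measure_ball// -mulr_natr; congr EFin; lra.
apply: (@le_trans _ _ (\sum_(p <- E) lebesgue_measure (3 *` B p))%E).
  pose p0 : R * {posnum R} := (0, PosNum (@ltr01 R)).
  rewrite (big_nth p0) big_mkord.
  apply: (@content_subadditive _ _ _ lebesgue_measure K
    (fun k => 3 *` B (nth p0 E k)) (size E)).
  - by move=> k _; rewrite scale_ballE//; exact: measurable_ball.
  - exact: compact_measurable.
  - by apply: (subset_trans KE); rewrite (big_nth p0) big_mkord.
apply: (@le_trans _ _ (\sum_(p <- E) (6 / A)%:E * mass p.1 p.2%:num)%E).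
  rewrite big_seq [leRHS]big_seq; apply: lee_sum => p /ED /DS /set_mem Sp.
  rewrite leb3 -[(6 * _)%R](_ : 6 / A * (A * p.2%:num) = _); last first.
    by rewrite mulrA divfK// gt_eqF.
  by rewrite EFinM lee_wpmul2l ?heavy// lee_fin divr_ge0// ltW.
rewrite -ge0_sume_distrr; last by move=> p _; exact: integral_ge0.
rewrite lee_wpmul2l ?lee_fin ?divr_ge0 ?(ltW A0)//.
rewrite -(@ge0_integral_bigsetU _ _ _ _ _ (fun p => phi @^-1` B p))//.
- apply: ge0_subset_integral => //.
  by apply: bigsetU_measurable => p _; exact: measurable_preimage_ball.
- by move=> p; exact: measurable_preimage_ball.
- by move=> p q Ep Eq [t [tp tq]]; apply: tEB => //; exists (phi t).
- exact: measurable_funTS.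
Qed.

Lemma measurable_poisson_kernel (x y : R) : 0 < y ->
  measurable_fun [set: T] (fun t => y / ((phi t - x) ^+ 2 + y ^+ 2)).
Proof.
move=> y0; pose K (v : R) := y / ((v - x) ^+ 2 + y ^+ 2).
apply: (@measurableT_comp _ _ _ _ _ _ K) => //.
by apply: continuous_measurable_fun; exact: continuous_poisson_kernel.
Qed.

(** The dyadic bound, integrated termwise: the k-th ball has radius 2^(k+1) y
    and weight (4 / 4^k) / y, hence contributes at most 16 A / 2^(k+1). *)
Lemma poisson_integral_le_ball_averages (x y s A : R) :
  0 < y -> `|x - s| <= y ->
  (forall r, 0 < r -> (mass s r <= (A * r)%:E)%E) ->
  (\int[mu]_t ((y / ((phi t - x) ^+ 2 + y ^+ 2))%:E * g t) <= (16 * A)%:E)%E.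
Proof.
move=> y0 xs massA.
pose w (k : nat) : R := 4 / 4 ^+ k / y.
have w_ge0 k : 0 <= w k by rewrite !divr_ge0 ?exprn_ge0// ltW.
pose B (k : nat) : set T := phi @^-1` ball s (2 ^+ k.+1 * y).
have mB k : measurable (B k) by exact: measurable_preimage_ball.
pose u (k : nat) (t : T) : \bar R := ((w k)%:E * (g \_ (B k)) t)%E.
have gB_ge0 k t : (0 <= (g \_ (B k)) t)%E by apply: erestrict_ge0 => ? _.
have mgB k : measurable_fun [set: T] (g \_ (B k)).
  by apply/(measurable_restrictT _ (mB k)); exact: measurable_funTS.
have u_ge0 k t : (0 <= u k t)%E by rewrite mule_ge0// lee_fin.
have mu_ k : measurable_fun [set: T] (u k) by exact: emeasurable_funM.
have kernel_ge0 t : 0 <= y / ((phi t - x) ^+ 2 + y ^+ 2).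
  by rewrite divr_ge0 ?(ltW y0)// addr_ge0 ?sqr_ge0.
apply: (@le_trans _ _ (\int[mu]_t \sum_(k <oo) u k t)%E).
  apply: ge0_le_integral => //.
  - by move=> t _; rewrite mule_ge0// lee_fin.
  - apply: emeasurable_funM => //; apply/measurable_EFinP.
    exact: measurable_poisson_kernel.
  - exact: ge0_emeasurable_sum.
  - move=> t _.
    have [k [tk Kw]] := poisson_kernel_dyadic_bound (phi t) y0 xs.
    apply: le_trans (nneseries_lim_ge k.+1 (fun n _ _ => u_ge0 n t)).
    rewrite big_nat_recr//= -[leLHS]add0e leeD ?sume_ge0//.
    rewrite /u patchE mem_set; last by rewrite /B /= /ball /= distrC.
    by rewrite lee_wpmul2r// lee_fin.
rewrite integral_nneseries//.
have -> : (16 * A)%:E = (\sum_(k <oo) ((16 * A) / (2 ^ (k + 1))%:R)%:E)%E.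
  have /cvg_lim := @cvg_geometric_eseries_half R (16 * A) 0.
  by rewrite expr0 divr1 => <-.
apply: lee_nneseries => k _; first by move=> _; exact: integral_ge0.
rewrite ge0_integralZl_EFin// -integral_mkcond.
apply: (@le_trans _ _ ((w k)%:E * (A * (2 ^+ k.+1 * y))%:E)%E).
  by rewrite lee_wpmul2l ?lee_fin// massA// mulr_gt0// exprn_gt0.
rewrite -EFinM lee_fin /w addn1 natrX.
rewrite le_eqVlt; apply/orP; left; apply/eqP.
have -> : 4 ^+ k = (2 ^+ k) ^+ 2 :> R by rewrite exprAC (_ : 2 ^+ 2 = 4)//; ring.
rewrite [2 ^+ k.+1]exprS; field.
by rewrite expf_neq0// gt_eqF.
Qed.
End BallMasses.

(** * Integrals of complex-valued functions *)

Section ComplexModulus.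
Context {R : realType}.
Local Open Scope complex_scope.

Lemma cabs_ge0 (z : R[i]) : 0 <= cabs z.
Proof. by case: z => a b; exact: sqrtr_ge0. Qed.

Lemma cabs_realM (a : R) (z : R[i]) : 0 <= a -> cabs (a%:C * z) = a * cabs z.
Proof. by move=> a0; rewrite Normc.normcM /= expr0n addr0 sqrtr_sqr ger0_norm. Qed.

Lemma Re_realM (a : R) (z : R[i]) : complex.Re (a%:C * z) = a * complex.Re z.
Proof. by case: z => u v /=; rewrite mul0r subr0. Qed.

Lemma Im_realM (a : R) (z : R[i]) : complex.Im (a%:C * z) = a * complex.Im z.
Proof. by case: z => u v /=; rewrite mul0r addr0. Qed.

Lemma normr_Re_le_cabs (z : R[i]) : `|complex.Re z| <= cabs z.
Proof.
by case: z => a b /=; rewrite -sqrtr_sqr ler_wsqrtr// lerDl sqr_ge0.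
Qed.

Lemma normr_Im_le_cabs (z : R[i]) : `|complex.Im z| <= cabs z.
Proof.
by case: z => a b /=; rewrite -sqrtr_sqr ler_wsqrtr// lerDr sqr_ge0.
Qed.

Lemma cabs_le_normD (z : R[i]) : cabs z <= `|complex.Re z| + `|complex.Im z|.
Proof.
case: z => a b /=; rewrite -[leRHS]ger0_norm// -[leRHS]sqrtr_sqr ler_wsqrtr//.
rewrite sqrrD !real_normK ?num_real// addrAC lerDl.
by rewrite mulrn_wge0// mulr_ge0.
Qed.

Context {d : measure_display} {T : measurableType d}.
Variables (mu : {measure set T -> \bar R}) (g : T -> R[i]).
Hypothesis mRe : measurable_fun [set: T] (fun t => complex.Re (g t)).
Hypothesis mIm : measurable_fun [set: T] (fun t => complex.Im (g t)).

Lemma measurable_cabs : measurable_fun [set: T] (fun t => cabs (g t)).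
Proof.
have -> : (fun t => cabs (g t)) =
    Num.sqrt \o (fun t => complex.Re (g t) ^+ 2 + complex.Im (g t) ^+ 2).
  by apply/funext => t /=; case: (g t).
apply: measurableT_comp; last by apply: measurable_funD; exact: measurable_funX.
by apply: continuous_measurable_fun; exact: sqrt_continuous.
Qed.

Lemma norm1E : norm1 mu g = (\int[mu]_t (cabs (g t))%:E)%E.
Proof.
rewrite /norm1 Lnorm1; apply: eq_integral => t _.
by rewrite abse_EFin ger0_norm// cabs_ge0.
Qed.

(** If the extended integral of h is infinite, its real-valued version is 0, so
    passing to real values never increases the modulus. *)
Lemma normr_Rintegral_le_norm1 (h : T -> R) : measurable_fun [set: T] h ->
  (forall t, `|h t| <= cabs (g t)) ->
  (`|\int[mu]_t h t|%:E <= norm1 mu g)%E.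
Proof.
move=> mh hg; apply: (@le_trans _ _ `|\int[mu]_t (h t)%:E|%E).
  by rewrite /Rintegral; case: (integral _ _ _) => [r| |] //=; rewrite leey.
apply: (le_trans (le_abse_integral _ _ _)) => //; first exact/measurable_EFinP.
rewrite norm1E; apply: ge0_le_integral => //.
- by apply: measurableT_comp => //; exact/measurable_EFinP.
- by apply/measurable_EFinP; exact: measurable_cabs.
- by move=> t _; rewrite /= lee_fin.
Qed.

(** The factor 2 comes from treating the real and imaginary parts separately,
    which spares rotating the integral onto the real axis. *)
Lemma cabs_cintegral_le :
  ((cabs (cintegral mu g))%:E <= 2%:E * norm1 mu g)%E.
Proof.
apply: (@le_trans _ _ (`|\int[mu]_t complex.Re (g t)|%:E
                     + `|\int[mu]_t complex.Im (g t)|%:E)%E).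
  by rewrite -EFinD lee_fin; exact: cabs_le_normD.
rewrite (_ : 2%:E = 1 + 1)%E// ge0_muleDl// mul1e.
apply: leeD; apply: normr_Rintegral_le_norm1 => // t.
- exact: normr_Re_le_cabs.
- exact: normr_Im_le_cabs.
Qed.

End ComplexModulus.

(** * The angular maximal Poisson transform *)

(** The real line with the sigma-algebra of all Lebesgue measurable sets, the
    domain of the completed Lebesgue measure. *)
Local Notation completedR R := (caratheodory_type ((wlength (@idfun R))^*)%mu).

Section PoissonTransform.
Context {R : realType}.
Local Notation leb := (@completed_lebesgue_measure R).
Local Open Scope complex_scope.
Implicit Types f : R -> R[i].

Lemma measurable_id_completed :
  @measurable_fun _ _ (completedR R) R [set: R] id.
Proof. by move=> _ Y mY; rewrite setTI; exact: sub_caratheodory. Qed.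

Lemma cabs_poisson_le f (x y s A : R) :
  inL1 leb f -> 0 < y -> `|x - s| <= y ->
  (forall r, 0 < r ->
     (\int[leb]_(t in ball s r) (cabs (f t))%:E <= (A * r)%:E)%E) ->
  cabs (poisson f (x +i* y)) <= 32 * A.
Proof.
move=> [mRe mIm _] y0 xs avgA.
pose K (t : R) : R := y / ((t - x) ^+ 2 + y ^+ 2).
have K_ge0 t : 0 <= K t by rewrite divr_ge0 ?(ltW y0)// addr_ge0 ?sqr_ge0.
have mK := measurable_poisson_kernel measurable_id_completed x y0.
have mabs := measurable_cabs mRe mIm.
have intK : (\int[leb]_t ((K t)%:E * (cabs (f t))%:E) <= (16 * A)%:E)%E.
  apply: (@poisson_integral_le_ball_averages _ _ _ leb id
            (fun t => (cabs (f t))%:E) measurable_id_completed _ _ x y s) => //.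
  - exact/measurable_EFinP.
  - by move=> t; rewrite lee_fin cabs_ge0.
have pi_ge1 : 1 <= pi :> R by rewrite (le_trans _ (pi_ge2 R))// ler1n.
rewrite /poisson cabs_realM ?invr_ge0 ?pi_ge0//.
rewrite mulrC ler_pdivrMr ?pi_gt0//.
have : (cabs (cintegral leb (fun t => (K t)%:C * f t)) <= 32 * A)%R.
  rewrite -lee_fin; apply: le_trans (cabs_cintegral_le _ _ _) _.
  - by under eq_fun do rewrite Re_realM; exact: measurable_funM.
  - by under eq_fun do rewrite Im_realM; exact: measurable_funM.
  - rewrite norm1E (_ : 32 * A = 2 * (16 * A))%R; last by ring.
    rewrite EFinM lee_wpmul2l//.
    by under eq_integral do rewrite cabs_realM// EFinM.
move=> le32; apply: (le_trans le32).
by rewrite ler_peMr// (le_trans _ le32)// cabs_ge0.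
Qed.

(** From sin^2 = (1 - cos) (1 + cos): the smaller of the two factors is at most
    sin. *)
Lemma angular_point_in_cone (rho theta : R) : 0 < rho -> 0 < theta < pi ->
  `|rho * cos theta - rho| <= rho * sin theta \/
  `|rho * cos theta - - rho| <= rho * sin theta.
Proof.
move=> rho0 thetapi; have sin0 := sin_gt0_pi thetapi.
have cs := cos2Dsin2 theta.
have c_le1 := cos_le1 theta; have c_geN1 := cos_geN1 theta.
have [c0|c0] := leP 0 (cos theta); [left|right].
  rewrite -{2}[rho]mulr1 -mulrBr normrM gtr0_norm// ler_pM2l// ler_norml.
  by apply/andP; split; nra.
rewrite opprK -{2}[rho]mulr1 -mulrDr normrM gtr0_norm// ler_pM2l// ler_norml.
by apply/andP; split; nra.
Qed.

(** The contrapositive of cabs_poisson_le, with A = lambda / 32. *)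
Lemma poisson_heavy_ball f (x y s lambda : R) :
  inL1 leb f -> 0 < y -> `|x - s| <= y ->
  lambda < cabs (poisson f (x +i* y)) ->
  exists r : {posnum R}, ((lambda / 32 * r%:num)%:E
     <= \int[leb]_(t in ball s r%:num) (cabs (f t))%:E)%E.
Proof.
move=> fL1 y0 xs; apply: contraPP => /forallNP light; apply/negP; rewrite -leNgt.
rewrite [leRHS](_ : lambda = 32 * (lambda / 32)); last by field.
apply: (cabs_poisson_le fL1 y0 xs) => r r0.
by have /negP := light (PosNum r0); rewrite -ltNge => /ltW.
Qed.

Lemma angular_maximal_poisson_heavy_ball f (rho lambda : R) :
  inL1 leb f -> 0 < rho -> (lambda%:E < angular_maximal_poisson f rho)%E ->
  exists s, (s = rho \/ s = - rho) /\
  exists r : {posnum R}, ((lambda / 32 * r%:num)%:E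
     <= \int[leb]_(t in ball s r%:num) (cabs (f t))%:E)%E.
Proof.
move=> fL1 rho0 /ereal_sup_gt [_ [theta thetapi <-]]; rewrite lte_fin.
have -> : rho%:C * (cos theta +i* sin theta)
        = (rho * cos theta) +i* (rho * sin theta).
  by apply/eqP; rewrite eq_complex /= !mul0r subr0 addr0 !eqxx.
have y0 : 0 < rho * sin theta by rewrite mulr_gt0 ?sin_gt0_pi.
have [cone|cone] := angular_point_in_cone rho0 thetapi => big.
- by exists rho; split; [left|exact: poisson_heavy_ball cone big].
- by exists (- rho); split; [right|exact: poisson_heavy_ball cone big].
Qed.

End PoissonTransform.

Theorem theorem1 (R : realType) :
  exists K1 : R, forall f : R -> R[i], inL1 (@completed_lebesgue_measure R) f ->
    forall lambda : R, 0 < lambda ->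
      (completed_lebesgue_measure
         [set rho : R | (0 < rho)%R /\
                        lambda%:E < angular_maximal_poisson f rho]
       <= (K1 / lambda)%:E * norm1 (@completed_lebesgue_measure R) f)%E.
Proof.
exists 384 => f fL1 lambda lambda0; have [mRe mIm _] := fL1.
have mabs := measurable_cabs mRe mIm.
have abs_ge0 t : (0 <= (cabs (f t))%:E)%E by rewrite lee_fin cabs_ge0.
have A0 : 0 < lambda / 32 by rewrite divr_gt0.
pose heavy (phi : R -> R) := [set p : R * {posnum R} |
  ((lambda / 32 * p.2%:num)%:E <=
     \int[@completed_lebesgue_measure R]_(t in phi @^-1` ball p.1 p.2%:num)
        (cabs (f t))%:E)%E].
pose U phi := \bigcup_(p in heavy phi) ball p.1 p.2%:num.
have covered : [set rho : R | (0 < rho)%R /\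
      (lambda%:E < angular_maximal_poisson f rho)%E] `<=` U id `|` U -%R.
  move=> rho /= [rho0] /(angular_maximal_poisson_heavy_ball fL1 rho0).
  move=> [s [[->|->] [r heavy_r]]]; [left|right]; exists (rho, r);
    rewrite /heavy /=; try exact: ballxx.
  - exact: heavy_r.
  - suff -> : -%R @^-1` ball rho r%:num = ball (- rho) r%:num by [].
    apply/funext => t; rewrite /ball /=.
    by rewrite -normrN opprB addrC.
have mN := measurableT_comp (@oppr_measurable R setT) (@measurable_id_completed R).
have half phi : @measurable_fun _ _ (completedR R) R setT phi ->
    (lebesgue_measure (U phi) <= (192 / lambda)%:E *
      norm1 (@completed_lebesgue_measure R) f)%E.
  move=> mphi; rewrite norm1E (_ : 192 / lambda = 6 / (lambda / 32)); last first.
    by field; rewrite gt_eqF.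
  apply: (@lebesgue_heavy_balls_le _ _ _ (@completed_lebesgue_measure R) phi
    (fun t => (cabs (f t))%:E) mphi) => //.
  exact/measurable_EFinP.
(* The completed and the Borel Lebesgue measures are the same outer measure on
   arbitrary sets: the level set, possibly non-measurable, can be compared
   with the open sets U. *)
apply: (@le_trans _ _ (lebesgue_measure (U id `|` U -%R))).
  exact: le_outer_measure.
apply: (le_trans (outer_measureU2 _ _ _)).
rewrite (_ : 384 / lambda = 192 / lambda + 192 / lambda); last first.
  by field; rewrite gt_eqF.
rewrite EFinD ge0_muleDl ?lee_fin ?divr_ge0 ?(ltW lambda0)//.
by apply: leeD; apply: half => //; exact: measurable_id_completed.
Qed.
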